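(* Let $G$ be a finite group, $H$ a normal subgroup of prime index $p$, $a\in G\setminus H$, $\mathbb{F}$ a field, and $V$ a $G$-stable irreducible $\mathbb{F}H$-module with $\mathbb{F}$-basis $e_0,\dots,e_{d-1}$, representation $\sigma\colon H\to\mathrm{GL}(V)$ and $\Delta=\mathrm{End}_{\mathbb{F}H}(V)$. Let $\alpha\in\mathrm{Aut}_{\mathbb{F}}(V)$ satisfy $(aha^{-1})\sigma=\alpha(h\sigma)\alpha^{-1}$ for all $h\in H$, and put $\lambda=\alpha^{-p}(a^p\sigma)\in\Delta^\times$. Then the representation $\sigma{\uparrow}\colon G\to\mathrm{GL}(V{\uparrow})$ afforded by the induced module $V{\uparrow}=V\otimes_{\mathbb{F}H}\mathbb{F}G$ relative to the $\mathbb{F}$-basis $$e_0,\dots,e_{d-1},\ \dots,\ e_0\alpha^{-i}a^i,\dots,e_{d-1}\alpha^{-i}a^i,\ \dots,\ e_0\alpha^{-(p-1)}a^{p-1},\dots,e_{d-1}\alpha^{-(p-1)}a^{p-1}$$ is given by the $p\times p$ block matrices (with blocks of size $d\times d$) $$a\sigma{\uparrow}=\begin{pmatrix}0&\alpha& &0\\ & &\ddots& \\0&0& &\alpha\\ \alpha\lambda&0& &0\end{pmatrix},\qquad h\sigma{\uparrow}=\mathrm{diag}(h\sigma,h\sigma,\dots,h\sigma)\quad(h\in H).$$ Moreover, there is an isomorphism from the general cyclic algebra $(\Delta,\alpha,\lambda)$ to $\mathrm{End}_{\mathbb{F}G}(V{\uparrow})$ given by $$(\Delta,\alpha,\lambda)\to\mathrm{End}_{\mathbb{F}G}(V{\uparrow})\colon\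 \sum_{i=0}^{p-1}\delta_ix^i\mapsto\sum_{i=0}^{p-1}D(\delta_i)X^i,$$ where, relative to the $\mathbb{F}$-basis $e_j\alpha^{-i}a^i$ of $V{\uparrow}$ ($0\le i\le p-1$, $0\le j\le d-1$, ordered first by $i$ and then by $j$), $$X=\begin{pmatrix}0&I& &0\\ & &\ddots& \\0&0& &I\\ \lambda&0& &0\end{pmatrix},\qquad D(\delta)=\mathrm{diag}(\delta,\alpha(\delta),\dots,\alpha^{p-1}(\delta))\quad(\delta\in\Delta).$$
   Context: Conventions: modules are right modules; linear maps are written on the right and composed from left to right (so $v(\varphi\psi)=(v\varphi)\psi$), and matrices act on row vectors from the right, so endomorphism algebras are identified with algebras of matrices under matrix multiplication. $\sigma$ is the representation with $vh=v(h\sigma)$ for $v\in V$, $h\in H$. $V$ is $G$-stable if for each $g\in G$ the representation $h\mapsto(ghg^{-1})\sigma$ of $H$ is equivalent to $\sigma$; this guarantees that some $\alpha$ as in the claim exists. $\Delta=\mathrm{End}_{\mathbb{F}H}(V)$ is the set of $\delta\in\mathrm{End}_{\mathbb{F}}(V)$ commuting with every $h\sigma$; it is a division algebra, finite-dimensional over $\mathbb{F}$. In $V{\uparrow}$ we write $va^i$ for $v\otimes a^i$, so $e_j\alpha^{-i}a^i=(e_j\alpha^{-i})\otimes a^i$. The symbol $\alpha$ also denotes the automorphism $\delta\mapsto\alpha(\delta)=\alpha^{-1}\delta\alpha$ of $\Delta$. The element $\lambda=\alpha^{-p}(a^p\sigma)$ lies in $\Delta^\times$ and satisfies $\alpha(\lambda)=\lambda$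 and $\alpha^p(\delta)=\lambda\delta\lambda^{-1}$ for all $\delta\in\Delta$. Twisted polynomial ring: $\Delta[t;\alpha]$ consists of polynomials $\sum\delta_it^i$ with the usual addition and multiplication determined by $t\delta=\alpha(\delta)t$. The right ideal $(t^p-\lambda)\Delta[t;\alpha]$ is two-sided, and the general cyclic algebra $(\Delta,\alpha,\lambda)$ is the quotient ring $\Delta[t;\alpha]/(t^p-\lambda)\Delta[t;\alpha]$. With $x$ the image of $t$, its elements are written uniquely as $\sum_{i=0}^{p-1}\delta_ix^i$ with $\delta_i\in\Delta$, and $x^p=\lambda$, $x\delta=\alpha(\delta)x$. *)

(* Defs.v *)
From HB Require Import structures.
From mathcomp Require Import all_boot all_order all_algebra.
From mathcomp Require Import all_fingroup all_solvable all_character.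
From mathcomp Require Import generic_quotient ring_quotient.
From mathcomp Require Import boolp.

Set Implicit Arguments.
Unset Strict Implicit.
Unset Printing Implicit Defensive.

Import GRing.Theory.
Local Open Scope ring_scope.

(* Representations act on row vectors from the right, so *m is composition    *)
(* from left to right, and a right FG-module with a basis is an               *)
(* mx_representation.                                                         *)

Section EndoRing.

Variables (F : fieldType) (gT : finGroupType) (G : {group gT}) (n : nat).
Variable rG : mx_representation F G n.

Definition endo_pred : {pred 'M[F]_n} := fun f => centgmx rG f.

Record endo := Endo { endo_val :> 'M[F]_n; endoP : endo_val \in endo_pred }.

HB.instance Definition _ := [isSub for endo_val].
HB.instance Definition _ := [Choice of endo by <:].

Fact endo_subring_closed : subring_closed endo_pred.
Proof.
split=> [|f g /centgmxP cf /centgmxP cg|f g /centgmxP cf /centgmxP cg];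
  apply/centgmxP=> x Gx.
- by rewrite mul1mx mulmx1.
- by rewrite mulmxBl mulmxBr cf ?cg.
- by rewrite -[f * g]/(f *m g) -mulmxA cg // mulmxA cf // mulmxA.
Qed.
HB.instance Definition _ :=
  GRing.isSubringClosed.Build 'M[F]_n endo_pred endo_subring_closed.
HB.instance Definition _ :=
  GRing.SubChoice_isSubPzRing.Build _ _ endo endo_subring_closed.

Fact endo_scaler_closed : GRing.scaler_closed endo_pred.
Proof.
move=> c f /centgmxP cf; apply/centgmxP=> x Gx.
by rewrite -scalemxAl -scalemxAr cf.
Qed.
HB.instance Definition _ :=
  GRing.isScaleClosed.Build F 'M[F]_n endo_pred endo_scaler_closed.
HB.instance Definition _ := [SubZmodule_isSubLmodule of endo by <:].

End EndoRing.

(* The endomorphism ring of an irreducible module; irreducibility is recorded *)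
(* in the type because it makes the ring nontrivial (indeed a division ring). *)
Section Schur.

Variables (F : fieldType) (gT : finGroupType) (G : {group gT}) (n : nat).
Variable rG : mx_representation F G n.

Definition schur_ring of mx_irreducible rG := endo rG.

Variable irrG : mx_irreducible rG.
Local Notation D := (schur_ring irrG).

HB.instance Definition _ := SubType.copy D (endo rG).
HB.instance Definition _ := Choice.copy D (endo rG).
HB.instance Definition _ := GRing.PzRing.copy D (endo rG).
HB.instance Definition _ := GRing.Lmodule.copy D (endo rG).

Fact schur_ring_oner_neq0 : (1 : D) != 0.
Proof.
have [n_gt0 _] := (mx_irrP rG).1 irrG.
apply/eqP=> /(congr1 (@endo_val F gT G n rG))/eqP.
by rewrite -[endo_val 1]/(1%:M) -[endo_val 0]/0 -mxrank_eq0 mxrank1 eqn0Ngt n_gt0.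
Qed.
HB.instance Definition _ :=
  GRing.PzSemiRing_isNonZero.Build D schur_ring_oner_neq0.

Definition schur_unit : pred D := fun f => endo_val f \in unitmx.

Fact schur_inv_subproof (f : D) : invmx (endo_val f) \in endo_pred rG.
Proof.
have /centgmxP cf := endoP f; apply/centgmxP=> x Gx.
have [Uf | nUf] := boolP (endo_val f \in unitmx); last first.
  by rewrite /invmx (negPf nUf) cf.
by apply: (canRL (mulmxK Uf)); rewrite -mulmxA -cf // mulKmx.
Qed.
Definition schur_inv (f : D) : D := Endo (schur_inv_subproof f).

Fact schur_mulVf : {in schur_unit, left_inverse 1 schur_inv *%R}.
Proof. by move=> f Uf; apply: val_inj; apply: mulVmx. Qed.
Fact schur_mulfV : {in schur_unit, right_inverse 1 schur_inv *%R}.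
Proof. by move=> f Uf; apply: val_inj; apply: mulmxV. Qed.
Fact schur_unitP (f g : D) : g * f = 1 /\ f * g = 1 -> schur_unit f.
Proof. by case=> [/(congr1 val)/mulmx1_unit[]]. Qed.
Fact schur_inv_out : {in [predC schur_unit], schur_inv =1 id}.
Proof.
move=> f nUf; apply: val_inj => /=; rewrite /invmx ifN //.
Qed.
HB.instance Definition _ := GRing.NzRing_hasMulInverse.Build D
  schur_mulVf schur_mulfV schur_unitP schur_inv_out.

Lemma schur_ring_division (f : D) : f != 0 -> f \is a GRing.unit.
Proof.
by move=> nz_f; apply: (mx_Schur irrG (endoP f)); apply: contraNneq nz_f => f0;
  apply/eqP/val_inj.
Qed.

End Schur.

Section TwistedPolynomials.

Variable D : nzRingType.

(* D[t; alpha]: coefficients on the left of the powers of t, t d = alpha(d) t *)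
Definition twpoly of {rmorphism D -> D} := {poly D}.

Variable alpha : {rmorphism D -> D}.
Local Notation Dt := (twpoly alpha).
HB.instance Definition _ := GRing.Zmodule.copy Dt {poly D}.
Implicit Types p q r : Dt.

Definition twmul p q : Dt :=
  \poly_(k < size (p : {poly D}) + size (q : {poly D}))
    \sum_(i < k.+1) p`_i * iter i alpha q`_(k - i).

Lemma iter_rmorph0 i : iter i alpha 0 = 0.
Proof. by elim: i => //= i ->; rewrite rmorph0. Qed.
Lemma iter_rmorph1 i : iter i alpha 1 = 1.
Proof. by elim: i => //= i ->; rewrite rmorph1. Qed.
Lemma iter_rmorphD i : {morph iter i alpha : x y / x + y}.
Proof. by move=> x y; elim: i => //= i ->; rewrite rmorphD. Qed.
Lemma iter_rmorphM i : {morph iter i alpha : x y / x * y}.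
Proof. by move=> x y; elim: i => //= i ->; rewrite rmorphM. Qed.
Lemma iter_rmorph_sum i n (f : 'I_n -> D) (P : pred 'I_n) :
  iter i alpha (\sum_(j < n | P j) f j) = \sum_(j < n | P j) iter i alpha (f j).
Proof. exact: (big_morph _ (@iter_rmorphD i) (iter_rmorph0 i)). Qed.

Lemma coef_twmul p q k :
  (twmul p q)`_k = \sum_(i < k.+1) p`_i * iter i alpha q`_(k - i).
Proof.
rewrite coef_poly; case: ltnP => // le_k; rewrite big1 // => i _.
have [lt_i | le_i] := ltnP i (size (p : {poly D})); last first.
  by rewrite nth_default ?mul0r.
rewrite [q`_ _]nth_default ?iter_rmorph0 ?mulr0 //.
have le_ik: (i <= k)%N by rewrite -ltnS.
by rewrite leq_subRL // (leq_trans _ le_k) // leq_add2r ltnW.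
Qed.

Lemma coef_twmul_rev p q k :
  (twmul p q)`_k = \sum_(i < k.+1) p`_(k - i) * iter (k - i) alpha q`_i.
Proof.
rewrite coef_twmul (reindex_inj rev_ord_inj) /=.
by apply: eq_bigr => i _; rewrite subSS subKn // leq_ord.
Qed.

Fact twmulA : associative twmul.
Proof.
move=> p q r; apply/polyP=> i; rewrite coef_twmul coef_twmul_rev.
pose coef3 j k := p`_j * iter j alpha q`_(i - j - k)
                       * iter (i - k) alpha r`_k.
transitivity (\sum_(j < i.+1) \sum_(k < i.+1 | (k <= i - j)%N) coef3 j k).
  apply: eq_bigr => /= j _.
  rewrite coef_twmul_rev iter_rmorph_sum big_distrr /=.
  rewrite (big_ord_narrow_leq (leq_subr _ _)); apply: eq_bigr => k _.
  rewrite /coef3 iter_rmorphM mulrA -iterD; congr (_ * iter _ _ _) => /=.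
  have := leq_ord j; have := leq_ord k => lek lej.
  by rewrite addnBA // subnKC.
rewrite (exchange_big_dep predT) //=; apply: eq_bigr => k _.
transitivity (\sum_(j < i.+1 | (j <= i - k)%N) coef3 j k).
  apply: eq_bigl => j; rewrite -ltnS -(ltnS j) -!subSn ?leq_ord //.
  by rewrite -subn_gt0 -(subn_gt0 j) -!subnDA addnC.
rewrite (big_ord_narrow_leq (leq_subr _ _)) coef_twmul big_distrl /=.
by apply: eq_bigr => j _; rewrite /coef3 -!subnDA addnC.
Qed.

Fact tw1mul : left_id (1 : {poly D}) twmul.
Proof.
move=> p; apply/polyP => i; rewrite coef_twmul big_ord_recl subn0.
by rewrite big1 => [|j _]; rewrite coef1 ?mul0r // mul1r addr0.
Qed.

Fact twmul1 : right_id (1 : {poly D}) twmul.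
Proof.
move=> p; apply/polyP => i; rewrite coef_twmul_rev big_ord_recl subn0.
rewrite big1 => [|j _]; rewrite coef1 ?iter_rmorph0 ?mulr0 //.
by rewrite iter_rmorph1 mulr1 addr0.
Qed.

Fact twmulDl : left_distributive twmul +%R.
Proof.
move=> p q r; apply/polyP=> i; rewrite coefD !coef_twmul -big_split.
by apply: eq_bigr => j _; rewrite coefD mulrDl.
Qed.

Fact twmulDr : right_distributive twmul +%R.
Proof.
move=> p q r; apply/polyP=> i; rewrite coefD !coef_twmul -big_split.
by apply: eq_bigr => j _; rewrite coefD iter_rmorphD mulrDr.
Qed.

HB.instance Definition _ := GRing.Zmodule_isNzRing.Build Dt
  twmulA tw1mul twmul1 twmulDl twmulDr (oner_neq0 {poly D}).

Definition twC (c : D) : Dt := c%:P.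
Definition twX : Dt := 'X.

Lemma coef_twCM c p k : (twC c * p)`_k = c * p`_k.
Proof.
rewrite [LHS]coef_twmul big_ord_recl subn0 /twC coefC /= big1 ?addr0 // => i _.
by rewrite coefC mul0r.
Qed.

Lemma coef_twMC p c k : (p * twC c)`_k = p`_k * iter k alpha c.
Proof.
rewrite [LHS]coef_twmul_rev big_ord_recl subn0 /twC coefC /= big1 ?addr0 //.
by move=> i _; rewrite coefC iter_rmorph0 mulr0.
Qed.

Lemma coef_twXM p k : (twX * p)`_k = if k is k'.+1 then alpha p`_k' else 0.
Proof.
rewrite [LHS]coef_twmul /twX; case: k => [|k].
  by rewrite big_ord1 coefX mul0r.
rewrite big_ord_recl coefX mul0r add0r big_ord_recl coefX mul1r big1 ?addr0.
  by rewrite /= subSS subn0.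
by move=> i _; rewrite coefX mul0r.
Qed.

Lemma coef_twMX p k : (p * twX)`_k = if k is k'.+1 then p`_k' else 0.
Proof.
rewrite [LHS]coef_twmul_rev /twX; case: k => [|k].
  by rewrite big_ord1 coefX iter_rmorph0 mulr0.
rewrite big_ord_recl coefX iter_rmorph0 mulr0 add0r big_ord_recl coefX.
rewrite iter_rmorph1 mulr1 big1 ?addr0; first by rewrite /= subSS subn0.
by move=> i _; rewrite coefX iter_rmorph0 mulr0.
Qed.

Lemma twX_commute c : twX * twC c = twC (alpha c) * twX.
Proof.
apply/polyP=> k; rewrite coef_twXM coef_twMX; case: k => // k.
by rewrite /twC !coefC; case: k => //=; rewrite rmorph0.
Qed.

Lemma coef_twXnM n p k :
  (twX ^+ n * p)`_k = if (k < n)%N then 0 else iter n alpha p`_(k - n).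
Proof.
elim: n k => [|n IHn] k; first by rewrite expr0 mul1r subn0.
rewrite exprS -mulrA coef_twXM; case: k => // k.
by rewrite IHn ltnS subSS; case: ifP => _; rewrite ?rmorph0.
Qed.

Lemma coef_twMXn n p k :
  (p * twX ^+ n)`_k = if (k < n)%N then 0 else p`_(k - n).
Proof.
elim: n k => [|n IHn] k; first by rewrite expr0 mulr1 subn0.
by rewrite exprSr mulrA coef_twMX; case: k => // k; rewrite IHn ltnS subSS.
Qed.

End TwistedPolynomials.

(* Conditions under which (t^n - lam) D[t; alpha] is a two-sided ideal, so    *)
(* that the general cyclic algebra (D, alpha, lam) of degree n is defined.    *)
Record cyclic_axiom (D : unitRingType) (alpha : {rmorphism D -> D}) (lam : D)
    (n : nat) : Prop := CyclicAxiom {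
  cyclic_degree_gt0 : (0 < n)%N;
  cyclic_aut : bijective alpha;
  cyclic_unit : lam \is a GRing.unit;
  cyclic_fix : alpha lam = lam;
  cyclic_iter : forall x, iter n alpha x = lam * x * lam^-1
}.

Section CyclicIdeal.

Variables (D : unitRingType) (alpha : {rmorphism D -> D}) (lam : D) (n : nat).
Local Notation Dt := (twpoly alpha).

Definition cyclic_gen : Dt := twX alpha ^+ n - twC alpha lam.

(* The right ideal; it is decided classically. *)
Definition cyclic_ideal : {pred Dt} :=
  fun u => `[< exists r : Dt, u = cyclic_gen * r >].

Lemma cyclic_idealP u :
  reflect (exists r : Dt, u = cyclic_gen * r) (u \in cyclic_ideal).
Proof. exact: asboolP. Qed.

Fact cyclic_ideal_zmod : zmod_closed cyclic_ideal.
Proof.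
split=> [|u v /cyclic_idealP[r ->] /cyclic_idealP[s ->]]; apply/cyclic_idealP.
  by exists 0; rewrite mulr0.
by exists (r - s); rewrite mulrBr.
Qed.
HB.instance Definition _ :=
  GRing.isZmodClosed.Build Dt cyclic_ideal cyclic_ideal_zmod.

Lemma cyclic_idealMr u v : u \in cyclic_ideal -> u * v \in cyclic_ideal.
Proof.
move=> /cyclic_idealP[r ->]; apply/cyclic_idealP.
by exists (r * v); rewrite mulrA.
Qed.

Hypothesis ax : cyclic_axiom alpha lam n.

Lemma cyclic_gen_comm (u : Dt) : exists u' : Dt, u * cyclic_gen = cyclic_gen * u'.
Proof.
have Ulam := cyclic_unit ax.
exists (map_poly (fun x => lam^-1 * x * lam) (u : {poly D}) : Dt).
have f0 : lam^-1 * 0 * lam = 0 by rewrite mulr0 mul0r.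
have fix_lam i : iter i alpha lam = lam.
  by elim: i => //= i ->; apply: cyclic_fix ax.
apply/polyP=> k; rewrite mulrBr mulrBl !coefB.
rewrite coef_twMXn coef_twXnM coef_twMC coef_twCM !coef_map_id0 // fix_lam.
rewrite !mulrA divrr // mul1r; congr (_ - _); case: ifP => // _.
by rewrite (cyclic_iter ax) !mulrA divrr // mul1r mulrK.
Qed.

Lemma cyclic_idealMl u v : v \in cyclic_ideal -> u * v \in cyclic_ideal.
Proof.
move=> /cyclic_idealP[r ->]; have [u' eq_u'] := cyclic_gen_comm u.
by apply/cyclic_idealP; exists (u' * r); rewrite mulrA eq_u' mulrA.
Qed.

End CyclicIdeal.

Section CyclicAlgebra.

Variables (D : unitRingType) (alpha : {rmorphism D -> D}) (lam : D) (n : nat).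
Local Notation Dt := (twpoly alpha).
Local Notation I := (cyclic_ideal (alpha := alpha) lam n).

Definition cyclic_algebra of cyclic_axiom alpha lam n :=
  Quotient.quot I.

Variable ax : cyclic_axiom alpha lam n.
Local Notation A := (cyclic_algebra ax).
Local Open Scope quotient_scope.

HB.instance Definition _ := GRing.Zmodule.copy A (Quotient.quot I).
HB.instance Definition _ :=
  EqQuotient.copy A (Quotient.quot I).

Lemma cyclic_quotP (u v : Dt) : reflect (u = v %[mod A]) (u - v \in I).
Proof. by rewrite Quotient.idealrBE; apply: eqP. Qed.

Definition cyclic_one : A := \pi_A 1.
Definition cyclic_mul (x y : A) : A := \pi_A (repr x * repr y).

Lemma pi_cyclic_mul (u v : Dt) : cyclic_mul (\pi_A u) (\pi_A v) = \pi_A (u * v).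
Proof.
apply/cyclic_quotP; set u' := repr _; set v' := repr _.
have Iu : u' - u \in I by apply/cyclic_quotP; rewrite reprK.
have Iv : v' - v \in I by apply/cyclic_quotP; rewrite reprK.
have ->: u' * v' - u * v = (u' - u) * v' + u * (v' - v).
  by rewrite mulrBl mulrBr addrA subrK.
by apply: rpredD; [apply: cyclic_idealMr | apply: (cyclic_idealMl ax)].
Qed.

Lemma pi_cyclic_add (u v : Dt) : \pi_A u + \pi_A v = \pi_A (u + v).
Proof. by symmetry; apply: Quotient.pi_add. Qed.

Fact cyclic_mulA : associative cyclic_mul.
Proof.
elim/quotW=> x; elim/quotW=> y; elim/quotW=> z.
rewrite (pi_cyclic_mul y z) (pi_cyclic_mul x (y * z)) mulrA.
by rewrite (pi_cyclic_mul x y) (pi_cyclic_mul (x * y) z).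
Qed.
Fact cyclic_mul1x : left_id cyclic_one cyclic_mul.
Proof. by elim/quotW=> x; rewrite (pi_cyclic_mul 1 x) mul1r. Qed.
Fact cyclic_mulx1 : right_id cyclic_one cyclic_mul.
Proof. by elim/quotW=> x; rewrite (pi_cyclic_mul x 1) mulr1. Qed.
Fact cyclic_mulDl : left_distributive cyclic_mul +%R.
Proof.
elim/quotW=> x; elim/quotW=> y; elim/quotW=> z.
rewrite pi_cyclic_add (pi_cyclic_mul (x + y)) (pi_cyclic_mul x).
by rewrite (pi_cyclic_mul y) pi_cyclic_add mulrDl.
Qed.
Fact cyclic_mulDr : right_distributive cyclic_mul +%R.
Proof.
elim/quotW=> x; elim/quotW=> y; elim/quotW=> z.
rewrite pi_cyclic_add (pi_cyclic_mul x (y + z)) (pi_cyclic_mul x y).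
by rewrite (pi_cyclic_mul x z) pi_cyclic_add mulrDr.
Qed.
HB.instance Definition _ := GRing.Zmodule_isPzRing.Build A
  cyclic_mulA cyclic_mul1x cyclic_mulx1 cyclic_mulDl cyclic_mulDr.

Definition cyclic_const (c : D) : A := \pi_A (twC alpha c).
Definition cyclic_x : A := \pi_A (twX alpha).

End CyclicAlgebra.

Section InducedModule.

Variables (F : fieldType) (gT : finGroupType) (G H : {group gT}) (d : nat).
Variable sigma : mx_representation F H d.

(* The group algebra FG is 'rV_#|G|, with canonical basis indexed through     *)
(* gring_index, and V (x)_F FG is the space of d x #|G| matrices, flattened   *)
(* by mxvec: v (x) w is the outer product v^T w.                              *)
Definition pretensor (v : 'rV[F]_d) (x : gT) : 'rV[F]_(d * gcard G) :=
  mxvec (v^T *m delta_mx 0 (gring_index G x)).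

Definition pretensor_act (g : gT) : 'M[F]_(d * gcard G) :=
  lin_mulmxr (regular_repr F G g).

Fact pretensor_act_repr : mx_repr G pretensor_act.
Proof.
split=> [|g h Gg Gh]; apply/row_matrixP=> i; rewrite !rowE.
  rewrite -[delta_mx 0 i]vec_mxK mul_vec_lin /= repr_mx1 mulmx1.
  by rewrite vec_mxK mulmx1.
rewrite mulmxA -[delta_mx 0 i]vec_mxK !mul_vec_lin /= repr_mxM //.
by rewrite mulmxA.
Qed.
Canonical pretensor_repr := MxRepresentation pretensor_act_repr.

(* The subspace spanned by all v h (x) x - v (x) h x, for v in V, h in H, and *)
(* x in G: the kernel of V (x)_F FG -> V (x)_FH FG.                           *)
Definition tensor_rel : 'M[F]_(d * gcard G) :=
  (\sum_(h in H) \sum_(x in G)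
     <<lin1_mx (fun v =>
         pretensor (v *m sigma h) x - pretensor v (h * x)%g)%R>>)%MS.

Lemma pretensorJ v x g :
  x \in G -> pretensor v x *m pretensor_act g = pretensor v (x * g)%g.
Proof.
move=> Gx; rewrite /pretensor mul_vec_lin /= -mulmxA -rowE rowK.
by rewrite gring_indexK.
Qed.

Lemma row_lin1 m n (f : 'rV[F]_m -> 'rV[F]_n) i :
  row i (lin1_mx f) = f (delta_mx 0 i).
Proof. by apply/rowP=> j; rewrite !mxE. Qed.

Fact tensor_rel_module : H \subset G -> mxmodule pretensor_repr tensor_rel.
Proof.
move=> sHG; apply/mxmoduleP=> g Gg; rewrite sumsmxMr; apply/sumsmx_subP=> h Hh.
have Gh := subsetP sHG h Hh.
rewrite sumsmxMr; apply/sumsmx_subP=> x Gx.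
apply: submx_trans (sumsmx_sup h Hh (submx_refl _)).
apply: submx_trans (sumsmx_sup (x * g)%g (groupM Gx Gg) (submx_refl _)).
rewrite (eqmxMr _ (genmxE _)) genmxE; apply/row_subP=> i.
rewrite row_mul row_lin1 mulmxBl !pretensorJ ?groupM // -mulgA.
by set L := lin1_mx _; apply: submx_trans (row_sub i L); rewrite row_lin1.
Qed.

Variable sHG : H \subset G.

(* V (x)_FH FG, with elementary tensors v (x) x given by tensor v x *)
Definition induced_repr := factmod_repr (tensor_rel_module sHG).

Definition tensor (v : 'rV[F]_d) (x : gT) := in_factmod tensor_rel (pretensor v x).

End InducedModule.

Section Stable.

Variables (F : fieldType) (gT : finGroupType) (G H : {group gT}) (d : nat).
Variable sigma : mx_representation F H d.
Hypothesis nsHG : (H <| G)%g.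

(* MathComp's h ^ g is g^-1 h g; the twist used here is h |-> g h g^-1. *)
Definition conjugate_mx (g : gT) (h : gT) : 'M[F]_d := sigma (g * h * g^-1)%g.

Fact conjugate_mx_repr g : g \in G -> mx_repr H (conjugate_mx g).
Proof.
move=> Gg; have nHg : (g^-1)%g \in 'N(H)%g.
  by rewrite groupV (subsetP (normal_norm nsHG)).
have HJ h : h \in H -> (g * h * g^-1)%g \in H.
  by move=> Hh; rewrite -[X in (X * _ * _)%g]invgK -mulgA memJ_norm.
split=> [|h k Hh Hk]; first by rewrite /conjugate_mx mulg1 mulgV repr_mx1.
rewrite /conjugate_mx -repr_mxM ?HJ //; congr (sigma _).
by rewrite -!mulgA mulKg.
Qed.
Definition conjugate_repr g (Gg : g \in G) :=
  MxRepresentation (conjugate_mx_repr Gg).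

Definition G_stable :=
  forall g (Gg : g \in G), mx_rsim (conjugate_repr Gg) sigma.

End Stable.

Section Extension.

Variables (F : fieldType) (gT : finGroupType) (G H : {group gT}) (d : nat).
Variables (sigma : mx_representation F H d) (irrV : mx_irreducible sigma).
Variables (p : nat) (a : gT) (alpha : 'M[F]_d).

Hypotheses (nsHG : (H <| G)%g) (p_pr : prime p) (indexH : #|G : H|%g = p).
Hypotheses (GHa : a \in G :\: H) (Ualpha : alpha \in unitmx).
Hypothesis alphaP : forall h, h \in H ->
  sigma (a * h * a^-1)%g = alpha *m sigma h *m invmx alpha.

Local Notation Delta := (schur_ring irrV).

Let Ga : a \in G. Proof. by have /setDP[] := GHa. Qed.
Let nHa : a \in 'N(H)%g. Proof. exact: (subsetP (normal_norm nsHG)). Qed.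
Let HaJ h : h \in H -> (a * h * a^-1)%g \in H.
Proof.
by move=> Hh; rewrite -[X in (X * _ * _)%g]invgK -mulgA memJ_norm ?groupV.
Qed.
Let Hap : (a ^+ p)%g \in H.
Proof.
have nHG := normal_norm nsHG; rewrite coset_idr ?groupX // morphX //.
have: (coset H a ^+ #|G / H| = 1)%g by apply: expg_cardG; apply: mem_quotient.
by rewrite card_quotient // indexH.
Qed.

Let alphaE h : h \in H -> sigma (a * h * a^-1)%g *m alpha = alpha *m sigma h.
Proof. by move=> Hh; rewrite alphaP // mulmxKV. Qed.

Fact delta_aut_subproof (f : Delta) :
  invmx alpha *m endo_val f *m alpha \in endo_pred sigma.
Proof.
have /centgmxP cf := endoP f; apply/centgmxP=> h Hh.
rewrite -!mulmxA -alphaE // [endo_val f *m _]mulmxA cf ?HaJ //.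
by rewrite !mulmxA; congr (_ *m _ *m _); apply: (canRL (mulmxK Ualpha));
  rewrite -mulmxA alphaE // mulKmx.
Qed.

Definition delta_aut (f : Delta) : Delta := Endo (delta_aut_subproof f).

Fact delta_aut_zmod : zmod_morphism delta_aut.
Proof. by move=> f g; apply: val_inj; rewrite /= mulmxBr mulmxBl. Qed.
Fact delta_aut_monoid : monoid_morphism delta_aut.
Proof.
split=> [|f g]; apply: val_inj => /=; first by rewrite mulmx1 mulVmx.
rewrite -[RHS]/(_ *m _ *m alpha *m (_ *m _ *m alpha)).
by rewrite !mulmxA mulmxK.
Qed.
HB.instance Definition _ :=
  GRing.isZmodMorphism.Build Delta Delta delta_aut delta_aut_zmod.
HB.instance Definition _ :=
  GRing.isMonoidMorphism.Build Delta Delta delta_aut delta_aut_monoid.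

Let alphaXE i h : h \in H ->
  sigma (a ^+ i * h * a ^- i)%g *m alpha ^+ i = alpha ^+ i *m sigma h.
Proof.
elim: i => [|i IHi] in h *; first by rewrite mul1g invg1 mulg1 mulmx1 mul1mx.
move=> Hh; rewrite expgSr exprSr.
rewrite (_ : _ * h * _ = a ^+ i * (a * h * a^-1) * a ^- i)%g; last first.
  by rewrite invMg !mulgA.
by rewrite -[alpha ^+ i * _]/(_ *m _) mulmxA IHi ?HaJ // -!mulmxA alphaE.
Qed.

Let UalphaX i : alpha ^+ i \in unitmx.
Proof.
elim: i => [|i IHi]; first by rewrite expr0 unitmx1.
by rewrite exprS -[_ * _]/(_ *m _) unitmx_mul Ualpha.
Qed.

Let invmxX i : invmx alpha ^+ i = invmx (alpha ^+ i).
Proof.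
have VA: invmx alpha * alpha = 1 by apply: mulVmx.
have c: GRing.comm (invmx alpha) alpha by rewrite /GRing.comm VA; apply/esym/mulmxV.
rewrite -[LHS]mulmx1 -(mulmxV (UalphaX i)) mulmxA.
by rewrite -[_ *m alpha ^+ i]/(_ * _) -exprMn_comm // VA expr1n mul1mx.
Qed.

Fact delta_lam_subproof :
  invmx alpha ^+ p *m sigma (a ^+ p)%g \in endo_pred sigma.
Proof.
apply/centgmxP=> h Hh; rewrite invmxX -mulmxA -repr_mxM //.
apply: (canLR (mulKmx (UalphaX p))); rewrite !mulmxA -alphaXE // mulmxK //.
by rewrite -repr_mxM ?mulgKV ?groupM ?groupV //.
Qed.

Definition delta_lam : Delta := Endo delta_lam_subproof.

Let delta_autE (f : Delta) :
  endo_val (delta_aut f) = invmx alpha *m endo_val f *m alpha.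
Proof. by []. Qed.

Let iter_delta_aut i (f : Delta) :
  alpha ^+ i *m endo_val (iter i delta_aut f) = endo_val f *m alpha ^+ i.
Proof.
elim: i => [|i IHi]; first by rewrite mul1mx mulmx1.
rewrite iterS delta_autE exprSr -[_ * alpha]/(_ *m _) -!mulmxA mulKVmx //.
by rewrite !mulmxA IHi.
Qed.

Fact delta_cyclic_axiom : cyclic_axiom delta_aut delta_lam p.
Proof.
have Usap : sigma (a ^+ p)%g \in unitmx by rewrite repr_mx_unit.
have Ulam : endo_val delta_lam \in unitmx.
  by rewrite /= invmxX unitmx_mul unitmx_inv UalphaX.
split=> //; first exact: prime_gt0.
- pose g (f : 'M[F]_d) := alpha *m f *m invmx alpha.
  have gP (f : Delta) : g (endo_val f) \in endo_pred sigma.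
    have /centgmxP cf := endoP f; apply/centgmxP=> h Hh; rewrite /g.
    have HJa : (a^-1 * h * a)%g \in H by rewrite -mulgA memJ_norm.
    have defh : sigma h = alpha *m sigma (a^-1 * h * a)%g *m invmx alpha.
      by rewrite -alphaP // !mulgA mulgV mul1g mulgK.
    rewrite defh !mulmxA mulmxKV // mulmxKV //.
    by rewrite -[_ *m endo_val f *m _]mulmxA cf // mulmxA.
  exists (fun f : Delta => Endo (gP f) : Delta) => f; apply: val_inj => /=.
    by rewrite /g !mulmxA mulmxV // mul1mx mulmxK.
  by rewrite /g !mulmxA mulVmx // mul1mx mulmxKV.
- apply: val_inj; apply: (can_inj (mulKmx (UalphaX 1))); rewrite expr1.
  rewrite [val (delta_aut _)]delta_autE -!mulmxA mulKVmx //=.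
  rewrite invmxX; apply: (can_inj (mulKmx (UalphaX p))).
  rewrite !mulmxA mulmxV // mul1mx -[_ *m alpha *m _]/(alpha ^+ p * alpha * _).
  rewrite -exprSr exprS -[_ * _ * _]/(_ *m _ *m _) mulmxK // -alphaE //.
  by rewrite -expgS expgSr mulgK.
- move=> f; apply: val_inj; apply: (can_inj (mulKmx (UalphaX p))).
  rewrite [LHS]iter_delta_aut; apply: (can_inj (mulmxK Ulam)).
  rewrite [val _](_ : _ = endo_val delta_lam *m endo_val f *m
                          invmx (endo_val delta_lam)) //.
  rewrite -[RHS]mulmxA mulmxKV // /= invmxX.
  rewrite -!mulmxA (mulKVmx (UalphaX p)) (mulKVmx (UalphaX p)).
  by have /centgmxP/(_ _ Hap) := endoP f.
Qed.

End Extension.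

Section Blocks.

Variables (F : fieldType) (d p : nat).

(* A on the superdiagonal, C in the lower left corner; for p = 1 only C.      *)
Definition block_shift (A C : 'M[F]_d) : 'M[F]_(\sum_(i < p) d) :=
  \mxblock_(i < p, j < p)
    (if j == i.+1 :> nat then A
     else if (i.+1 == p) && (j == 0 :> nat) then C else 0).

Variables (gT : finGroupType) (G H : {group gT}).
Variables (sigma : mx_representation F H d).

(* The (i, j)-th row is e_j alpha^-i (x) a^i, ordered first by i, then by j.  *)
Definition induced_basis (a : gT) (e alpha : 'M[F]_d) :=
  \mxcol_(i < p) \matrix_(j < d)
    tensor G sigma (row j e *m invmx alpha ^+ i) (a ^+ i)%g.

End Blocks.

(* Main.v *)
(* The FG-endomorphisms of the induced module correspond to the FH-maps from V
   into it (Frobenius reciprocity). As FH-module it is the direct sum of the p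
   copies V alpha^-i a^i of V, so such a map has coordinates delta_0, ...,
   delta_(p-1) in Delta. Writing D(delta) and X for the endomorphisms extending
   v |-> v delta and v |-> v alpha^-1 a, one gets X D(delta) = D(alpha delta) X
   and X^p = D(lambda) by evaluating on V only. Hence the cyclic algebra maps to
   the endomorphism ring, and sum_i D(delta_i) X^i is the endomorphism with
   coordinates delta_i, which makes this map bijective. *)

From HB Require Import structures.
Require Import Defs.
From mathcomp Require Import all_boot all_order all_algebra.
From mathcomp Require Import all_fingroup all_solvable all_character.
From mathcomp Require Import generic_quotient.

Set Implicit Arguments.
Unset Strict Implicit.
Unset Printing Implicit Defensive.

Import GRing.Theory.
Local Open Scope ring_scope.

(** * The universal property of V (x)_FH FG in matrix form *)

Section Tensor.

Variables (F : fieldType) (gT : finGroupType) (G H : {group gT}) (d : nat).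
Variables (sigma : mx_representation F H d) (sHG : H \subset G).
Local Notation U := (tensor_rel G sigma).
Local Notation sigmaG := (induced_repr sigma sHG).

Lemma pretensor_is_linear x :
  linear (fun v : 'rV[F]_d => pretensor G v x).
Proof.
move=> c u v.
by rewrite /pretensor !linearP /= mulmxDl -scalemxAl linearP.
Qed.

Definition pretensor_linear x : {linear 'rV[F]_d -> 'rV[F]_(d * gcard G)} :=
  HB.pack (fun v : 'rV[F]_d => pretensor G v x)
    (GRing.isLinear.Build F _ _ _ (fun v : 'rV[F]_d => pretensor G v x)
       (pretensor_is_linear x)).

Definition tensor_mx (x : gT) : 'M[F]_(d, \rank (cokermx U)) :=
  lin1_mx (in_factmod U \o pretensor_linear x).

Lemma tensorE v x : tensor G sigma v x = v *m tensor_mx x.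
Proof. by rewrite mul_rV_lin1. Qed.

(** [tensor_rel] records the relations through [lin1_mx], hence only on basis vectors; linearity in
    [v] extends them to all of V. *)
Lemma pretensor_rel v h x : h \in H -> x \in G ->
  (pretensor G (v *m sigma h) x - pretensor G v (h * x)%g <= U)%MS.
Proof.
move=> Hh Gx; apply: submx_trans (sumsmx_sup h Hh (submx_refl _)).
apply: submx_trans (sumsmx_sup x Gx (submx_refl _)); rewrite genmxE.
pose g w := pretensor G (w *m sigma h) x - pretensor G w (h * x)%g.
have lg : linear g.
  move=> c u w; rewrite /g mulmxDl -scalemxAl !pretensor_is_linear.
  by rewrite scalerBr opprD addrACA.
pose gL : {linear _ -> _} := HB.pack g (GRing.isLinear.Build F _ _ _ g lg).
by rewrite -[X in (X <= _)%MS](mul_rV_lin1 gL) submxMl.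
Qed.

Lemma mul_tensor_mx h x : h \in H -> x \in G ->
  sigma h *m tensor_mx x = tensor_mx (h * x)%g.
Proof.
move=> Hh Gx; apply/row_matrixP => i; rewrite !rowE mulmxA -!tensorE.
apply/eqP; rewrite -subr_eq0 -linearB in_factmod_eq0.
exact: pretensor_rel.
Qed.

Lemma tensor_mxJ x g : x \in G -> g \in G ->
  tensor_mx x *m sigmaG g = tensor_mx (x * g)%g.
Proof.
move=> Gx Gg; apply/row_matrixP => i; rewrite !rowE mulmxA -!tensorE.
rewrite -[LHS]in_factmodJ //; congr (in_factmod _ _); exact: pretensorJ.
Qed.

(** The quotient map is onto and the outer products of basis vectors span V (x)_F FG, so the classes
    e_i (x) x span the quotient. *)
Lemma tensor_mx_full m (W : 'M[F]_(m, \rank (cokermx U))) :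
  (forall x, x \in G -> (tensor_mx x <= W)%MS) -> row_full W.
Proof.
move=> sW; rewrite -sub1mx -[1%:M](val_factmodK (U := U)) in_factmodE.
apply: submx_trans (submxMl _ _) _; apply/row_subP => k.
have [i [j ->]] : exists i : 'I_d, exists j, k = mxvec_index i j.
  by case/mxvec_indexP: k => i j; exists i, j.
have [x Gx ->] : exists2 x, x \in G & j = gring_index G x.
  by exists (enum_val j); rewrite ?enum_valP ?gring_valK.
suff -> : row (mxvec_index i (gring_index G x)) (in_factmod U 1%:M)
     = delta_mx 0 i *m tensor_mx x.
  exact: submx_trans (submxMl _ _) (sW x Gx).
rewrite -tensorE rowE -in_factmodE /tensor /pretensor -mxvec_delta.
by rewrite trmx_delta mul_delta_mx.
Qed.

(** A balanced family defines a map on V (x)_F FG that kills the relations, so it descends to the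
    quotient. *)
Lemma tensor_lift m (T : gT -> 'M[F]_(d, m)) :
    (forall h x, h \in H -> x \in G -> T (h * x)%g = sigma h *m T x) ->
  {S : 'M[F]_(\rank (cokermx U), m) |
    forall x, x \in G -> tensor_mx x *m S = T x}.
Proof.
move=> balT.
(* Column [j] of [vec_mx w] is the vector of V paired with the group element [enum_val j]. *)
pose g (w : 'rV[F]_(d * gcard G)) : 'rV_m :=
  \sum_(j < gcard G) (vec_mx w *m delta_mx j (0 : 'I_1))^T *m T (enum_val j).
have lg : linear g.
  move=> c u w; rewrite /g scaler_sumr -big_split /=; apply: eq_bigr => j _.
  by rewrite linearP /= mulmxDl -scalemxAl linearP /= mulmxDl -scalemxAl.
pose gL : {linear _ -> _} := HB.pack g (GRing.isLinear.Build F _ _ _ g lg).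
pose P := lin1_mx gL.
have gP v x : x \in G -> pretensor G v x *m P = v *m T x.
  move=> Gx; rewrite mul_rV_lin1 /= /g /pretensor mxvecK.
  rewrite (bigD1 (gring_index G x)) //= big1 => [|j /negPf nj].
    have -> : v^T *m delta_mx 0 (gring_index G x)
        *m delta_mx (gring_index G x) 0 = v^T.
      by apply/colP=> i; rewrite -mulmxA mul_delta_mx !mxE big_ord1 !mxE mulr1.
    by rewrite trmxK gring_indexK // addr0.
  by rewrite -mulmxA mul_delta_mx_0 ?mulmx0 ?trmx0 ?mul0mx // eq_sym nj.
have UP : U *m P = 0.
  apply/eqP; rewrite -submx0 sumsmxMr_gen; apply/sumsmx_subP => h Hh.
  rewrite genmxE sumsmxMr_gen; apply/sumsmx_subP => x Gx.
  rewrite genmxE (eqmxMr _ (genmxE _)); apply/row_subP=> i.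
  rewrite row_mul row_lin1 mulmxBl !gP ?balT //; last first.
    by rewrite groupM // (subsetP sHG).
  by rewrite mulmxA subrr sub0mx.
(* [val_factmod] picks representatives in V (x)_F FG; they differ from the pure tensors by elements
   of [U], which [P] annihilates. *)
exists (val_factmod 1%:M *m P) => x Gx; apply/row_matrixP => i.
rewrite !rowE 2!mulmxA -tensorE -val_factmodE.
have /(congr1 (mulmx^~ P)) := add_sub_fact_mod U (pretensor G (delta_mx 0 i) x).
rewrite mulmxDl gP // => <-.
have /submxP[w ->] :=
  val_submodP (in_submod U (pretensor G (delta_mx 0 i) x)).
by rewrite -mulmxA UP mulmx0 add0r.
Qed.

End Tensor.

(** * Evaluation of twisted polynomials *)

Section TwistedEvaluation.

Variables (D : nzRingType) (alpha : {rmorphism D -> D}).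
Local Notation Dt := (twpoly alpha).

Lemma twCM b c : twC alpha (b * c) = twC alpha b * twC alpha c.
Proof.
apply/polyP => k; rewrite coef_twCM /twC !coefC.
by case: ifP; rewrite ?mulr0.
Qed.

Lemma coef_twXn k i : (twX alpha ^+ k)`_i = (i == k)%:R.
Proof.
rewrite -[_ ^+ k]mul1r coef_twMXn coef1 subn_eq0.
by case: ltngtP.
Qed.

Lemma twpolyE m (u : Dt) : (size (u : {poly D}) <= m)%N ->
  u = \sum_(i < m) twC alpha u`_i * twX alpha ^+ i.
Proof.
move=> le_um; apply/polyP => k.
rewrite (big_morph (fun v : Dt => v`_k) (fun v w => coefD v w k) (coef0 _ k)).
under eq_bigr do rewrite coef_twCM coef_twXn mulr_natr mulrb.
rewrite -big_mkcond; have [lt_km | le_mk] := ltnP k m; last first.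
  rewrite nth_default ?(leq_trans le_um) // big1 // => i /eqP ki.
  by rewrite ki leqNgt ltn_ord in le_mk.
by rewrite (big_pred1 (Ordinal lt_km)) // => i; rewrite -val_eqE eq_sym.
Qed.

Variables (R : pzRingType) (phi : {rmorphism D -> R}) (x : R).

Definition tweval (u : Dt) : R :=
  \sum_(i < size (u : {poly D})) phi u`_i * x ^+ i.

(** Coefficients beyond the size vanish, so polynomials of different sizes can be evaluated over one
    common range, as additivity requires. *)
Lemma twevalE m (u : Dt) : (size (u : {poly D}) <= m)%N ->
  tweval u = \sum_(i < m) phi u`_i * x ^+ i.
Proof.
move=> le_um; rewrite /tweval.
rewrite (big_ord_widen m (fun i => phi u`_i * x ^+ i) le_um) big_mkcond.
apply: eq_bigr => i _; rewrite ltnNge.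
by case: ifP => // /negbFE le_ui; rewrite nth_default // rmorph0 mul0r.
Qed.

Lemma tweval_is_zmod_morphism : zmod_morphism tweval.
Proof.
move=> u v; pose m := maxn (size (u : {poly D})) (size (v : {poly D})).
have le_um : (size (u : {poly D}) <= m)%N by apply: leq_maxl.
have le_vm : (size (v : {poly D}) <= m)%N by apply: leq_maxr.
have le_uvm : (size ((u - v)%R : {poly D}) <= m)%N.
  by rewrite (leq_trans (size_polyD _ _)) ?size_polyN.
rewrite (twevalE le_um) (twevalE le_vm) (twevalE le_uvm) -sumrB.
by apply: eq_bigr => i _; rewrite coefB rmorphB mulrBl.
Qed.

HB.instance Definition _ :=
  GRing.isZmodMorphism.Build Dt R tweval tweval_is_zmod_morphism.

Lemma tweval_monomial c k :
  tweval (twC alpha c * twX alpha ^+ k) = phi c * x ^+ k.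
Proof.
have le_k : (size ((twC alpha c * twX alpha ^+ k)%R : {poly D}) <= k.+1)%N.
  apply/leq_sizeP => j lt_kj.
  by rewrite coef_twCM coef_twXn gtn_eqF // mulr0.
rewrite (twevalE le_k) big_ord_recr /= big1 => [|i _].
  by rewrite coef_twCM coef_twXn eqxx mulr1 add0r.
by rewrite coef_twCM coef_twXn ltn_eqF // mulr0 rmorph0 mul0r.
Qed.

Lemma tweval_twC c : tweval (twC alpha c) = phi c.
Proof. by have := tweval_monomial c 0; rewrite !expr0 !mulr1. Qed.

Lemma tweval_twXn k : tweval (twX alpha ^+ k) = x ^+ k.
Proof.
rewrite -[twX alpha ^+ k](mul1r (twX alpha ^+ k)) (tweval_monomial 1 k).
by rewrite rmorph1 mul1r.
Qed.

End TwistedEvaluation.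

(** Each factor [x] that passes a constant contributes one [alpha]. With bare functions this covers
    the constants of D[t; alpha], those of the cyclic algebra and the target of an evaluation
    alike. *)
Lemma twistXn (D R : pzRingType) (alpha : D -> D) (phi : D -> R) (x : R) :
    (forall c, x * phi c = phi (alpha c) * x) ->
  forall k c, x ^+ k * phi c = phi (iter k alpha c) * x ^+ k.
Proof.
move=> xphi; elim=> [|k IHk] c; first by rewrite !expr0 mul1r mulr1.
by rewrite exprS -mulrA IHk mulrA xphi -mulrA.
Qed.

(** The hypothesis on [x] mirrors the rule t c = alpha(c) t, so evaluation respects products of
    monomials, and additivity does the rest. *)
Lemma tweval_is_monoid_morphism (D : nzRingType) (alpha : {rmorphism D -> D})
    (R : pzRingType) (phi : {rmorphism D -> R}) (x : R) :
    (forall c, x * phi c = phi (alpha c) * x) ->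
  monoid_morphism (tweval phi x : twpoly alpha -> R).
Proof.
move=> xphi; split=> [|u v].
  by have := tweval_twXn alpha phi x 0; rewrite !expr0.
rewrite {1}(twpolyE (leqnn (size (u : {poly D})))).
rewrite {1}(twpolyE (leqnn (size (v : {poly D})))).
rewrite mulr_suml raddf_sum /tweval mulr_suml; apply: eq_bigr => i _.
rewrite mulr_sumr raddf_sum mulr_sumr; apply: eq_bigr => j _ /=.
have tC c : twX alpha * twC alpha c = twC alpha (alpha c) * twX alpha.
  exact: twX_commute.
rewrite -mulrA [in LHS](mulrA (twX alpha ^+ i)) (twistXn tC).
rewrite -(mulrA _ (twX alpha ^+ i)) -exprD.
rewrite mulrA -twCM tweval_monomial rmorphM exprD -!mulrA; congr (_ * _).
by rewrite !mulrA (twistXn xphi).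
Qed.

(** * The cyclic algebra: span by monomials and universal property *)

Section CyclicLift.

Variables (D : unitRingType) (alpha : {rmorphism D -> D}) (lam : D) (n : nat).
Variable ax : cyclic_axiom alpha lam n.
Local Notation Dt := (twpoly alpha).
Local Notation A := (cyclic_algebra ax).
Local Open Scope quotient_scope.

Definition cyclic_pi (u : Dt) : A := \pi_A u.

Lemma cyclic_pi_is_zmod_morphism : zmod_morphism cyclic_pi.
Proof.
move=> u v; apply/eqP; rewrite eq_sym subr_eq; apply/eqP.
by rewrite [RHS]pi_cyclic_add subrK.
Qed.

Lemma cyclic_pi_is_monoid_morphism : monoid_morphism cyclic_pi.
Proof. by split=> // u v; rewrite [RHS]pi_cyclic_mul. Qed.

HB.instance Definition _ :=
  GRing.isZmodMorphism.Build Dt A cyclic_pi cyclic_pi_is_zmod_morphism.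
HB.instance Definition _ :=
  GRing.isMonoidMorphism.Build Dt A cyclic_pi cyclic_pi_is_monoid_morphism.

Lemma cyclic_xn : cyclic_x ax ^+ n = cyclic_const ax lam.
Proof.
rewrite -[cyclic_x ax]/(cyclic_pi _) -rmorphXn; apply/cyclic_quotP.
by apply/cyclic_idealP; exists 1; rewrite mulr1.
Qed.

(** Since x^n is the constant lambda, an exponent of at least n can be lowered by n at the cost of a
    twisted lambda in the coefficient. *)
Lemma cyclic_algebra_span (u : A) :
  exists delta : 'I_n -> D,
    u = \sum_(i < n) cyclic_const ax (delta i) * cyclic_x ax ^+ i.
Proof.
have n_gt0 := cyclic_degree_gt0 ax.
have constM b c :
    cyclic_const ax (b * c) = cyclic_const ax b * cyclic_const ax c.
  by rewrite -[RHS](rmorphM cyclic_pi); congr cyclic_pi; apply: twCM.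
have constD b c :
    cyclic_const ax (b + c) = cyclic_const ax b + cyclic_const ax c.
  by rewrite -[RHS](rmorphD cyclic_pi); congr cyclic_pi; apply: polyCD.
have const0 : cyclic_const ax 0 = 0.
  by rewrite -[RHS](rmorph0 cyclic_pi); congr cyclic_pi; apply: polyC0.
have xC c : cyclic_x ax * cyclic_const ax c
    = cyclic_const ax (alpha c) * cyclic_x ax.
  by rewrite -[LHS](rmorphM cyclic_pi) twX_commute rmorphM.
have mon k c : exists delta : 'I_n -> D, cyclic_const ax c * cyclic_x ax ^+ k
    = \sum_(i < n) cyclic_const ax (delta i) * cyclic_x ax ^+ i.
  elim/ltn_ind: k => k IHk in c *; have [lt_kn | le_nk] := ltnP k n.
    exists (fun i => if i == Ordinal lt_kn then c else 0).
    rewrite (bigD1 (Ordinal lt_kn)) //= eqxx big1 ?addr0 // => i /negPf ->.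
    by rewrite const0 mul0r.
  have lt_k : (k - n < k)%N by rewrite ltn_subrL n_gt0 (leq_trans n_gt0).
  (* Here c x^k = c x^(k-n) lambda, and moving lambda to the left past x^(k-n) applies [alpha] k - n
     times. *)
  have [delta def_delta] := IHk _ lt_k (c * iter (k - n) alpha lam).
  exists delta; rewrite -def_delta -{1}(subnK le_nk) exprD cyclic_xn.
  by rewrite (twistXn xC) constM mulrA.
elim/quotW: u => u; rewrite (twpolyE (leqnn (size (u : {poly D})))).
rewrite -[\pi_A _]/(cyclic_pi _) rmorph_sum /=.
apply: (big_ind (fun v => exists delta : 'I_n -> D,
  v = \sum_(i < n) cyclic_const ax (delta i) * cyclic_x ax ^+ i)).
- by exists (fun=> 0); rewrite big1 // => i _; rewrite const0 mul0r.
- move=> _ _ [b ->] [c ->]; exists (fun i => b i + c i).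
  by rewrite -big_split; apply: eq_bigr => i _; rewrite constD mulrDl.
by move=> i _; rewrite rmorphM rmorphXn; apply: mon.
Qed.

(** Evaluation at [x] sends the generator t^n - lambda to zero, hence also the right ideal it
    generates, and so factors through the quotient. *)
Lemma cyclic_lift (R : pzRingType) (phi : {rmorphism D -> R}) (x : R) :
    (forall c, x * phi c = phi (alpha c) * x) -> x ^+ n = phi lam ->
  exists f : {rmorphism A -> R},
    (forall c, f (cyclic_const ax c) = phi c) /\ f (cyclic_x ax) = x.
Proof.
move=> xphi xn; pose ev : {rmorphism Dt -> R} :=
  HB.pack (tweval phi x : Dt -> R)
    (GRing.isZmodMorphism.Build Dt R _ (tweval_is_zmod_morphism phi x))
    (GRing.isMonoidMorphism.Build Dt R _ (tweval_is_monoid_morphism xphi)).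
(* [f] is computed on chosen representatives; [f_pi] shows that the choice does not matter. *)
pose f (u : A) : R := ev (repr u).
have f_pi u : f (cyclic_pi u) = ev u.
  apply/eqP; rewrite -subr_eq0 -rmorphB; apply/eqP.
  have /cyclic_idealP[r ->] : repr (cyclic_pi u) - u \in cyclic_ideal lam n.
    by apply/(cyclic_quotP ax); rewrite reprK.
  rewrite rmorphM rmorphB rmorphXn /=.
  rewrite (tweval_twC alpha phi x lam) -[twX alpha]expr1 tweval_twXn expr1 xn.
  by rewrite subrr mul0r.
have fB : zmod_morphism f.
  elim/quotW=> u; elim/quotW=> v; rewrite -[\pi_A u]/(cyclic_pi u).
  by rewrite -[\pi_A v]/(cyclic_pi v) -rmorphB !f_pi rmorphB.
have fM : monoid_morphism f.
  split; first by rewrite -(rmorph1 cyclic_pi) f_pi rmorph1.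
  elim/quotW=> u; elim/quotW=> v; rewrite -[\pi_A u]/(cyclic_pi u).
  by rewrite -[\pi_A v]/(cyclic_pi v) -rmorphM !f_pi rmorphM.
pose fR : {rmorphism A -> R} :=
  HB.pack f (GRing.isZmodMorphism.Build A R f fB)
    (GRing.isMonoidMorphism.Build A R f fM).
exists fR; split=> [c|] /=; rewrite [LHS]f_pi; first exact: tweval_twC.
by have := tweval_twXn alpha phi x 1; rewrite !expr1.
Qed.

End CyclicLift.

(** * Conjugation by a basis stacked in blocks *)

Section BlockConjugation.

Variables (F : fieldType) (p d n : nat).

(** The two dimensions of [B] need not be the same term, so [conjmx] uses a pseudo-inverse; for a
    row-free [B] it is a genuine right inverse. *)
Lemma conjmx_eq m (B : 'M[F]_(m, n)) Y Z :
  row_free B -> B *m Y = Z *m B -> conjmx B Y = Z.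
Proof. by move=> freeB eqB; rewrite /conjmx eqB mulmxKp. Qed.

Lemma submx_mxcol (b : 'I_p -> 'M[F]_(d, n)) i : (b i <= \mxcol_j b j)%MS.
Proof.
rewrite -{1}[b i](mxcolK b) /submxcol.
by apply/row_subP => j; rewrite row_rowsub row_sub.
Qed.

(** Each block row of [block_shift] has one block that can be nonzero: [A] right of the diagonal or,
    in the last row, [C] in column 0. Indexing [b] by nat lets [b i.+1] be written without a bound
    proof. *)
Lemma mul_block_shift_mxcol (b : nat -> 'M[F]_(d, n)) (A C : 'M[F]_d) Y :
    (0 < p)%N -> (forall i, (i.+1 < p)%N -> b i *m Y = A *m b i.+1) ->
    b p.-1 *m Y = C *m b 0%N ->
  (\mxcol_(i < p) b i) *m Y = block_shift p A C *m \mxcol_(i < p) b i.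
Proof.
move=> p_gt0 bY bpY; rewrite mxcol_mul mul_mxblock_mxrow.
apply/eq_mxcol => i; have [lt_ip | le_pi] := ltnP i.+1 p.
  rewrite (bigD1 (Ordinal lt_ip)) //= eqxx big1 ?addr0 ?bY // => j.
  by rewrite -val_eqE /= => /negPf ->; rewrite ltn_eqF //= mul0mx.
have ip : i.+1 = p by apply/eqP; rewrite eqn_leq ltn_ord.
rewrite (bigD1 (Ordinal p_gt0)) //= ip eqxx /= big1 ?addr0 => [|j].
  by rewrite -bpY -(congr1 predn ip).
by rewrite -val_eqE /= => /negPf ->; rewrite ltn_eqF // mul0mx.
Qed.

End BlockConjugation.

(** * Powers of a as representatives of the cosets of H *)

Section PrimeIndex.

Variables (gT : finGroupType) (G H : {group gT}) (p : nat) (a : gT).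
Hypotheses (nsHG : (H <| G)%g) (p_pr : prime p) (indexH : #|G : H|%g = p).
Hypothesis GHa : a \in G :\: H.

Let Ga : a \in G. Proof. by have /setDP[] := GHa. Qed.
Let nHG := normal_norm nsHG.

Let mem_coset x : x \in G -> (x \in H) = (coset H x == 1)%g.
Proof.
move=> Gx; apply/idP/eqP => [/coset_id // |].
exact/coset_idr/(subsetP nHG).
Qed.

(** The order divides |G/H| = p and is not 1 because a lies outside H. *)
Lemma order_coset_prime_index : #[coset H a]%g = p.
Proof.
have /setDP[_ notHa] := GHa.
have : (#[coset H a]%g %| p)%N.
  by rewrite -indexH -card_quotient // order_dvdG ?mem_quotient.
case/primeP: p_pr => _ dvdp /dvdp/orP[|/eqP //].
by rewrite order_eq1 -mem_coset // (negPf notHa).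
Qed.

Lemma expg_mem_prime_index k : ((a ^+ k)%g \in H) = (p %| k)%N.
Proof.
rewrite mem_coset ?groupX //.
by rewrite morphX ?(subsetP nHG) // -order_dvdn order_coset_prime_index.
Qed.

(** Two distinct exponents below p differ by a number strictly between 0 and p, which p cannot
    divide. *)
Lemma expg_coset_prime_index i j : (i < p)%N -> (j < p)%N ->
  ((a ^+ i * a ^- j)%g \in H) = (i == j).
Proof.
wlog le_ji : i j / (j <= i)%N => [IH lt_ip lt_jp|lt_ip _].
  have [/IH-> // | /ltnW/IH] := leqP j i.
  by rewrite eq_sym => <- //; rewrite -[LHS]groupV invMg invgK.
rewrite -[in (a ^+ i)%g](subnK le_ji) expgD mulgK expg_mem_prime_index.
case: eqVneq => [->|ne_ij].
  by rewrite subnn dvdn0.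
have lt_ji : (j < i)%N by rewrite ltn_neqAle eq_sym ne_ij.
by rewrite gtnNdvd ?subn_gt0 // (leq_ltn_trans (leq_subr _ _)).
Qed.

(** The coset of a has order p = |G/H|, so it generates the quotient. *)
Lemma prime_index_coset x : x \in G ->
  exists2 i, (i < p)%N & (x * a ^- i)%g \in H.
Proof.
move=> Gx; have Gax : coset H x \in <[coset H a]>%g.
  have /eqP-> // : <[coset H a]>%g == (G / H)%g; last exact: mem_quotient.
  rewrite eqEcard cycle_subG mem_quotient //= card_quotient // indexH.
  by rewrite -orderE order_coset_prime_index.
have [i lt_i eq_x] := cyclePmin Gax; rewrite order_coset_prime_index in lt_i.
exists i => //; rewrite mem_coset ?groupM ?groupV ?groupX //.
have [Nx Na] : x \in 'N(H)%g /\ a \in 'N(H)%g by split; apply: (subsetP nHG).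
by rewrite morphM ?morphV ?morphX ?groupV ?groupX //= eq_x mulgV.
Qed.

End PrimeIndex.

(* Row i of tm x stands for e_i (x) x. Working from this universal property
   keeps the quotient defining induced_repr out of the computations: mulmxA
   would otherwise unfold it. *)
Record induced_axiom (F : fieldType) (gT : finGroupType) (G H : {group gT})
    (d n : nat) (sigma : mx_representation F H d)
    (rG : mx_representation F G n) (tm : gT -> 'M[F]_(d, n)) := InducedAxiom {
  induced_mul : forall h x, h \in H -> x \in G ->
    sigma h *m tm x = tm (h * x)%g;
  induced_act : forall x g, x \in G -> g \in G -> tm x *m rG g = tm (x * g)%g;
  induced_full : forall m (W : 'M[F]_(m, n)),
    (forall x, x \in G -> (tm x <= W)%MS) -> row_full W;
  induced_lift : forall m (T : gT -> 'M[F]_(d, m)),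
    (forall h x, h \in H -> x \in G -> T (h * x)%g = sigma h *m T x) ->
    {S : 'M[F]_(n, m) | forall x, x \in G -> tm x *m S = T x}
}.

Definition induced_repr_axiom (F : fieldType) (gT : finGroupType)
    (G H : {group gT}) (d : nat) (sigma : mx_representation F H d)
    (sHG : H \subset G) :
  induced_axiom sigma (induced_repr sigma sHG) (tensor_mx G sigma) :=
  InducedAxiom (@mul_tensor_mx _ _ G H d sigma)
    (@tensor_mxJ _ _ G H d sigma sHG)
    (@tensor_mx_full _ _ G H d sigma) (@tensor_lift _ _ G H d sigma sHG).

(** * Twisted copies of V in the induced module *)

Section InducedEndomorphisms.

Variables (F : fieldType) (gT : finGroupType) (G H : {group gT}) (d : nat).
Variables (sigma : mx_representation F H d) (irrV : mx_irreducible sigma).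
Variables (p : nat) (a : gT) (alpha : 'M[F]_d).

Hypotheses (nsHG : (H <| G)%g) (p_pr : prime p) (indexH : #|G : H|%g = p).
Hypotheses (GHa : a \in G :\: H) (Ualpha : alpha \in unitmx).
Hypothesis alphaP : forall h, h \in H ->
  sigma (a * h * a^-1)%g = alpha *m sigma h *m invmx alpha.

Variables (n : nat) (sigmaG : mx_representation F G n).
Variable tm : gT -> 'M[F]_(d, n).
Hypothesis ind : induced_axiom sigma sigmaG tm.

Local Notation Delta := (schur_ring irrV).
Local Notation alphaD :=
  (delta_aut nsHG GHa Ualpha alphaP : {rmorphism Delta -> Delta}).
Local Notation lam := (delta_lam irrV nsHG indexH GHa Ualpha alphaP).
Local Notation ax :=
  (delta_cyclic_axiom irrV nsHG p_pr indexH GHa Ualpha alphaP).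

Let Ga : a \in G. Proof. by have /setDP[] := GHa. Qed.
Let GaX i : (a ^+ i)%g \in G. Proof. exact: groupX. Qed.
Let HG h : h \in H -> h \in G.
Proof. exact: subsetP (normal_sub nsHG) h. Qed.
Let HJ i h : h \in H -> (a ^+ i * h * a ^- i)%g \in H.
Proof.
move=> Hh; rewrite -[X in (X * _ * _)%g]invgK -mulgA.
by rewrite memJ_norm // groupV (subsetP (normal_norm nsHG)).
Qed.
Let p_gt0 := prime_gt0 p_pr.

(* Locked so that mulmxA does not reassociate inside it. *)
Definition twist k := locked (invmx alpha ^+ k *m tm (a ^+ k)%g).

Lemma twistE k : twist k = invmx alpha ^+ k *m tm (a ^+ k)%g.
Proof. by rewrite /twist -lock. Qed.

Lemma twist0 : twist 0 = tm 1%g.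
Proof. by rewrite twistE [LHS]mul1mx. Qed.

Lemma twistS k : twist k.+1 = invmx alpha *m (twist k *m sigmaG a).
Proof.
rewrite !twistE -[in RHS]mulmxA (induced_act ind) // -expgSr [RHS]mulmxA.
by rewrite exprS.
Qed.

Lemma twist_a k : twist k *m sigmaG a = alpha *m twist k.+1.
Proof. by rewrite twistS mulKVmx. Qed.

(** Passing h across a^k conjugates it, and alpha^-k intertwines the conjugated action with sigma;
    hence v |-> v alpha^-k a^k is FH-linear. *)
Lemma twistJ k h : h \in H -> twist k *m sigmaG h = sigma h *m twist k.
Proof.
have commJ i g : g \in H ->
    invmx alpha ^+ i *m sigma (a ^+ i * g * a ^- i)%g
      = sigma g *m invmx alpha ^+ i.
  move=> Hg; elim: i => [|i IHi].
    by rewrite !expr0 mul1mx mulmx1 mul1g invg1 mulg1.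
  rewrite exprSr expgS invMg -[_ * invmx alpha]/(_ *m _).
  have -> : (a * a ^+ i * g * (a ^- i * a^-1)
      = a * (a ^+ i * g * a ^- i) * a^-1)%g.
    by rewrite !mulgA.
  rewrite alphaP ?HJ // -!mulmxA (mulmxA (invmx alpha) alpha).
  by rewrite mulVmx // mul1mx mulmxA IHi mulmxA.
move=> Hh; rewrite !twistE -mulmxA (induced_act ind) ?GaX ?(HG Hh) //.
have -> : (a ^+ k * h = (a ^+ k * h * a ^- k) * a ^+ k)%g by rewrite mulgKV.
by rewrite -(induced_mul ind) ?HJ ?GaX // mulmxA commJ // mulmxA.
Qed.

(** a^p lies in H, so it crosses the tensor sign as sigma(a^p), which together with alpha^-p makes
    lambda. *)
Lemma twist_p : twist p = endo_val lam *m twist 0.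
Proof.
rewrite twist0 twistE /= -mulmxA (induced_mul ind) ?mulg1 //.
by rewrite (expg_mem_prime_index nsHG p_pr indexH GHa).
Qed.

Let alphaXV i : alpha ^+ i *m invmx alpha ^+ i = 1%:M.
Proof.
have aV : alpha * invmx alpha = 1 by apply: mulmxV.
have Va : invmx alpha * alpha = 1 by apply: mulVmx.
have comm : GRing.comm alpha (invmx alpha) by rewrite /GRing.comm aV Va.
by rewrite -[_ *m _]/(_ * _) -exprMn_comm // aV expr1n.
Qed.

Let alphaVX i : invmx alpha ^+ i *m alpha ^+ i = 1%:M.
Proof. exact: mulmx1C (alphaXV i). Qed.

Lemma induced_twist h i : h \in H ->
  tm (h * a ^+ i)%g = sigma h *m alpha ^+ i *m twist i.
Proof.
move=> Hh; rewrite -(induced_mul ind) // twistE -mulmxA (mulmxA (alpha ^+ i)).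
by rewrite alphaXV mul1mx.
Qed.

(** Every element of G is h a^i with i < p, so its tensors lie in the image of [twist i]. *)
Lemma twist_full m (W : 'M[F]_(m, n)) :
  (forall i, (i < p)%N -> (twist i <= W)%MS) -> row_full W.
Proof.
move=> sW; apply: (induced_full ind) => x Gx.
have [i lt_ip Hxi] := prime_index_coset nsHG p_pr indexH GHa Gx.
rewrite -[x](mulgKV (a ^+ i)%g) induced_twist //.
exact: submx_trans (submxMl _ _) (sW i lt_ip).
Qed.

Lemma twist_inj m (Y Z : 'M[F]_(n, m)) :
  (forall i, (i < p)%N -> twist i *m Y = twist i *m Z) -> Y = Z.
Proof.
move=> eqYZ; have full := twist_full (W := \mxcol_(i < p) twist i).
apply: (row_full_inj (full _)) => [i lt_ip|].
  exact: (submx_mxcol (fun j : 'I_p => twist j) (Ordinal lt_ip)).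
by rewrite !mxcol_mul; apply/eq_mxcol => i; apply: eqYZ.
Qed.

(** * Coordinates on the p copies of V *)

Lemma twist_dual j : (j < p)%N ->
  {S : 'M[F]_(n, d) |
    forall i, (i < p)%N -> twist i *m S = if i == j then 1%:M else 0}.
Proof.
move=> lt_jp.
(* [T] is supported on the coset H a^j and equals sigma(h) at h a^j. Being balanced it lifts to a
   map sending v (x) a^j to v; the factor alpha^j added below cancels the alpha^-j in [twist j]. *)
pose T x := if (x * a ^- j)%g \in H then sigma (x * a ^- j)%g else 0.
have [|S tmS] := induced_lift ind (m := d) (T := T).
  move=> h x Hh Gx; rewrite /T -mulgA groupMl //; case: ifP => Hx.
    by rewrite repr_mxM.
  by rewrite mulmx0.
exists (S *m alpha ^+ j) => i lt_ip.
rewrite twistE !mulmxA -(mulmxA _ _ S) tmS //.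
rewrite /T (expg_coset_prime_index nsHG p_pr indexH GHa) //.
case: eqVneq => [->|_]; last by rewrite mulmx0 mul0mx.
by rewrite mulgV repr_mx1 mulmx1 alphaVX.
Qed.

Definition dual (j : 'I_p) := sval (twist_dual (ltn_ord j)).

Lemma twist_dualE i j : (i < p)%N ->
  twist i *m dual j = if i == j then 1%:M else 0.
Proof. exact: (svalP (twist_dual (ltn_ord j))). Qed.

Lemma dual_twist : \sum_(j < p) dual j *m twist j = 1%:M.
Proof.
apply: twist_inj => i lt_ip; rewrite mulmx1 mulmx_sumr.
rewrite (bigD1 (Ordinal lt_ip)) //= mulmxA twist_dualE // eqxx mul1mx.
rewrite big1 ?addr0 // => j; rewrite -val_eqE eq_sym => /negPf /= ne_ij.
by rewrite mulmxA twist_dualE // ne_ij mul0mx.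
Qed.

Lemma dualJ j h : h \in H -> sigmaG h *m dual j = dual j *m sigma h.
Proof.
move=> Hh; apply: twist_inj => i lt_ip.
rewrite !mulmxA twistJ // twist_dualE // -mulmxA twist_dualE //.
by case: ifP => _; rewrite ?mulmx1 ?mul1mx ?mulmx0 ?mul0mx.
Qed.

(** * Frobenius reciprocity and the endomorphisms D(delta) and X *)

Lemma endo_twist_inj (f g : endo sigmaG) :
  twist 0 *m endo_val f = twist 0 *m endo_val g -> f = g.
Proof.
move=> eq_fg; apply: val_inj; apply: twist_inj => i _.
(* Copy i + 1 arises from copy i through alpha^-1 and a, and both endomorphisms commute with a, so
   agreement on V propagates. *)
elim: i => // i IHi; rewrite twistS -!mulmxA; congr (_ *m _).
have /centgmxP cf := endoP f; have /centgmxP cg := endoP g.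
by rewrite -cf // -cg // !mulmxA IHi.
Qed.

(** The family x |-> f x is balanced because [f] is FH-linear; its lift sends v (x) x to (v f) x and
    commutes with G. *)
Lemma endo_extension (f : 'M[F]_(d, n)) :
    (forall h, h \in H -> sigma h *m f = f *m sigmaG h) ->
  {g : endo sigmaG | twist 0 *m endo_val g = f}.
Proof.
move=> fJ; have [|S tmS] := induced_lift ind (T := fun x => f *m sigmaG x).
  by move=> h x Hh Gx /=; rewrite repr_mxM ?(HG Hh) // !mulmxA fJ.
have centS : S \in endo_pred sigmaG.
  apply/centgmxP => g Gg; apply: twist_inj => i _; rewrite twistE -!mulmxA.
  congr (_ *m _); rewrite !mulmxA (induced_act ind) // !tmS ?groupM //.
  by rewrite repr_mxM // mulmxA.
by exists (Endo centS); rewrite twist0 /= tmS ?group1 // repr_mx1 mulmx1.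
Qed.

Lemma delta_twistJ (delta : Delta) h : h \in H ->
  sigma h *m (endo_val delta *m twist 0)
    = endo_val delta *m twist 0 *m sigmaG h.
Proof.
move=> Hh; have /centgmxP c := endoP delta.
by rewrite -[RHS]mulmxA twistJ // !mulmxA c.
Qed.

Definition endo_diag (delta : Delta) : endo sigmaG :=
  sval (endo_extension (delta_twistJ delta)).

Lemma endo_diag0 delta :
  twist 0 *m endo_val (endo_diag delta) = endo_val delta *m twist 0.
Proof. exact: svalP (endo_extension (delta_twistJ delta)). Qed.

Definition endo_shift : endo sigmaG :=
  sval (endo_extension (fun h Hh => esym (twistJ 1 Hh))).

Lemma endo_shift0 : twist 0 *m endo_val endo_shift = twist 1.
Proof. exact: svalP (endo_extension (fun h Hh => esym (twistJ 1 Hh))). Qed.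

Lemma endo_shiftE k : twist k *m endo_val endo_shift = twist k.+1.
Proof.
elim: k => [|k IHk]; first exact: endo_shift0.
have /centgmxP c := endoP endo_shift.
by rewrite [in LHS]twistS -!mulmxA -c // (mulmxA (twist k)) IHk -twistS.
Qed.

(** Moving from copy k to copy k + 1 puts the coefficient between [invmx alpha] and [alpha], which
    is one more application of [alphaD]; this yields the diagonal blocks of D(delta). *)
Lemma endo_diagE k (delta : Delta) : twist k *m endo_val (endo_diag delta)
  = endo_val (iter k alphaD delta) *m twist k.
Proof.
elim: k => [|k IHk]; first exact: endo_diag0.
have /centgmxP c := endoP (endo_diag delta).
rewrite [in LHS]twistS -!mulmxA -c // (mulmxA (twist k)) IHk.
by rewrite -mulmxA twist_a !mulmxA.
Qed.

Lemma endo_valM (f g : endo sigmaG) :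
  endo_val (f * g) = endo_val f *m endo_val g.
Proof. by []. Qed.

Lemma endo_shift_expE k : twist 0 *m endo_val (endo_shift ^+ k) = twist k.
Proof.
elim: k => [|k IHk]; first exact: mulmx1.
by rewrite exprSr endo_valM mulmxA IHk endo_shiftE.
Qed.

Lemma endo_shift_p : endo_shift ^+ p = endo_diag lam.
Proof.
by apply: endo_twist_inj; rewrite endo_shift_expE endo_diag0 twist_p.
Qed.

Lemma endo_shift_diag delta :
  endo_shift * endo_diag delta = endo_diag (alphaD delta) * endo_shift.
Proof.
apply: endo_twist_inj; rewrite !endo_valM !mulmxA endo_shift0 endo_diag0.
by rewrite endo_diagE -[RHS]mulmxA endo_shift0.
Qed.

Lemma endo_diag_is_zmod_morphism : zmod_morphism endo_diag.
Proof.
move=> b c; apply: endo_twist_inj.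
rewrite -[endo_val (_ - _)]/(endo_val (endo_diag b) - endo_val (endo_diag c)).
by rewrite mulmxBr !endo_diag0 -mulmxBl.
Qed.

Lemma endo_diag_is_monoid_morphism : monoid_morphism endo_diag.
Proof.
split=> [|b c]; apply: endo_twist_inj.
  by rewrite endo_diag0 [RHS]mulmx1; apply: mul1mx.
rewrite endo_valM !mulmxA !endo_diag0 -[RHS]mulmxA endo_diag0.
by rewrite mulmxA.
Qed.

HB.instance Definition _ := GRing.isZmodMorphism.Build Delta (endo sigmaG)
  endo_diag endo_diag_is_zmod_morphism.
HB.instance Definition _ := GRing.isMonoidMorphism.Build Delta (endo sigmaG)
  endo_diag endo_diag_is_monoid_morphism.

Lemma endo_diag_scalar c :
  endo_diag (c *: (1 : Delta)) = c *: (1 : endo sigmaG).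
Proof.
apply: endo_twist_inj; rewrite endo_diag0.
rewrite -[endo_val _]/(c *: 1%:M) -[endo_val _ in RHS]/(c *: 1%:M).
by rewrite -scalemxAl -scalemxAr mul1mx mulmx1.
Qed.

(** On V the factor D(delta_i) acts as delta_i, and X^i then carries V to its i-th copy. *)
Lemma endo_sum_twist (delta : 'I_p -> Delta) :
  twist 0 *m endo_val (\sum_(i < p) endo_diag (delta i) * endo_shift ^+ i)
    = \sum_(i < p) endo_val (delta i) *m twist i.
Proof.
rewrite (big_morph (@endo_val _ _ _ _ sigmaG) (id1 := 0) (op1 := +%R)) //.
rewrite mulmx_sumr; apply: eq_bigr => i _.
by rewrite endo_valM mulmxA endo_diag0 -mulmxA endo_shift_expE.
Qed.

(** Restricting to V, applying [g] and projecting to a copy of V is a composite of FH-maps. *)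
Lemma endo_coef_subproof (g : endo sigmaG) (j : 'I_p) :
  twist 0 *m endo_val g *m dual j \in endo_pred sigma.
Proof.
have /centgmxP cg := endoP g; apply/centgmxP => h Hh.
rewrite !mulmxA -twistJ // -[LHS]mulmxA -dualJ // -!mulmxA.
by rewrite (mulmxA (sigmaG h)) -cg ?(HG Hh) // !mulmxA.
Qed.

Definition endo_coef g j : Delta := Endo (endo_coef_subproof g j).

(** The restriction of [g] to V is the sum of its components in the p copies; this is the source of
    surjectivity. *)
Lemma endo_coefK g :
  \sum_(i < p) endo_diag (endo_coef g i) * endo_shift ^+ i = g.
Proof.
apply: endo_twist_inj; rewrite endo_sum_twist.
rewrite -[RHS]mulmx1 -dual_twist mulmx_sumr.
by apply: eq_bigr => i _; rewrite mulmxA.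
Qed.

Lemma endo_sum_eq0 (delta : 'I_p -> Delta) :
  \sum_(i < p) endo_diag (delta i) * endo_shift ^+ i = 0 ->
  forall i, delta i = 0.
Proof.
move=> sum0 j; apply: val_inj => /=.
have : twist 0 *m endo_val (0 : endo sigmaG) *m dual j = 0.
  by rewrite mulmx0 mul0mx.
rewrite -sum0 endo_sum_twist mulmx_suml (bigD1 j) //= -mulmxA twist_dualE //.
rewrite eqxx mulmx1 big1 ?addr0 // => i /negPf ne_ij.
by rewrite -mulmxA twist_dualE // val_eqE ne_ij mulmx0.
Qed.

Lemma cyclic_endo_iso : exists f : {rmorphism cyclic_algebra ax -> endo sigmaG},
  [/\ bijective f,
      forall (c : F) (u : cyclic_algebra ax),
        f (cyclic_const ax (c *: (1 : Delta)) * u) = c *: f u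
    & forall delta : 'I_p -> Delta,
        f (\sum_(i < p) cyclic_const ax (delta i) * cyclic_x ax ^+ i)
          = \sum_(i < p) endo_diag (delta i) * endo_shift ^+ i].
Proof.
have [f [fC fX]] :=
  cyclic_lift ax (phi := endo_diag) endo_shift_diag endo_shift_p.
have fE delta : f (\sum_(i < p) cyclic_const ax (delta i) * cyclic_x ax ^+ i)
    = \sum_(i < p) endo_diag (delta i) * endo_shift ^+ i.
  by rewrite rmorph_sum; apply: eq_bigr => i _; rewrite rmorphM rmorphXn fC fX.
exists f; split=> // [|c u]; last first.
  rewrite rmorphM fC /= endo_diag_scalar; apply: val_inj.
  by rewrite -[LHS]/(c *: 1%:M *m endo_val (f u)) -scalemxAl mul1mx.
(* Reading off coordinates gives a section of [f], which is a two-sided inverse once [f] is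
   injective. *)
pose g h : cyclic_algebra ax :=
  \sum_(i < p) cyclic_const ax (endo_coef h i) * cyclic_x ax ^+ i.
have gK : cancel g f by move=> h; rewrite fE endo_coefK.
suff f_inj : injective f by exists g => // u; apply: f_inj.
(* A kernel element is a combination of monomials, and its coefficients vanish because those of its
   image do. *)
apply: raddf_inj => u; have [delta ->] := cyclic_algebra_span u.
move/(etrans (esym (fE delta)))/endo_sum_eq0 => delta0; rewrite big1 // => i _.
rewrite delta0 -[cyclic_const ax 0]/(cyclic_pi ax 0%:P).
by rewrite polyC0 (rmorph0 (cyclic_pi ax)) mul0r.
Qed.

(** * Matrices relative to the basis e_j alpha^-i a^i *)

Variable e : 'M[F]_d.
Hypothesis basis_e : e \in unitmx.
Local Notation B := (\mxcol_(i < p) (e *m twist i)).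

(** The dual maps, each followed by the inverse of [e], form a right inverse of the basis matrix. *)
Lemma twist_basis_free : row_free B.
Proof.
apply/row_freeP; exists (\mxrow_j (dual j *m invmx e)).
rewrite mul_mxcol_mxrow -mxdiagZ; apply/eq_mxblock => i j.
rewrite mulmxA -(mulmxA e) twist_dualE // val_eqE.
case: eqVneq => _; last by rewrite mulmx0 mul0mx.
by rewrite mulmx1 mulmxV // conform_mx_id.
Qed.

Lemma twist_basis_full : row_full B.
Proof.
apply: twist_full => i lt_ip.
apply: submx_trans (submx_mxcol _ (Ordinal lt_ip)).
by rewrite -[X in (X <= _)%MS](mulKmx basis_e) submxMl.
Qed.

Lemma twist_basis_diag Y (D : 'I_p -> 'M[F]_d) :
    (forall i : 'I_p, twist i *m Y = D i *m twist i) ->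
  B *m Y = (\mxdiag_(i < p) conjmx e (D i)) *m B.
Proof.
move=> twistY; rewrite mxcol_mul mul_mxdiag_mxcol.
apply/eq_mxcol => i; rewrite -mulmxA twistY conjumx // !mulmxA.
by rewrite mulmxKV.
Qed.

Lemma twist_basis_shift Y (A C : 'M[F]_d) :
    (forall i, (i.+1 < p)%N -> twist i *m Y = A *m twist i.+1) ->
    twist p.-1 *m Y = C *m twist 0 ->
  B *m Y = block_shift p (conjmx e A) (conjmx e C) *m B.
Proof.
move=> twistY twistpY.
apply: (mul_block_shift_mxcol (b := fun i => e *m twist i)) => // [i lt_ip|].
  by rewrite -mulmxA twistY // conjumx // !mulmxA mulmxKV.
by rewrite -mulmxA twistpY conjumx // !mulmxA mulmxKV.
Qed.

End InducedEndomorphisms.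

(** Links the basis of the statement, built from single tensors, to the maps [twist] on which the
    block computations rest. *)
Lemma induced_basisE (F : fieldType) (gT : finGroupType) (G H : {group gT})
    (d p : nat) (sigma : mx_representation F H d) (a : gT) (e alpha : 'M[F]_d) :
  induced_basis p G sigma a e alpha
    = \mxcol_(i < p) (e *m twist a alpha (tensor_mx G sigma) i).
Proof.
apply/eq_mxcol => i; apply/row_matrixP => j.
by rewrite rowK tensorE row_mul twistE mulmxA.
Qed.

Theorem theorem3
  (gT : finGroupType) (G H : {group gT}) (p : nat) (a : gT)
  (F : fieldType) (d : nat) (sigma : mx_representation F H d)
  (e alpha : 'M[F]_d)
  (nsHG : (H <| G)%g) (p_pr : prime p) (indexH : #|G : H|%g = p)
  (GHa : a \in G :\: H)
  (irrV : mx_irreducible sigma) (stabV : G_stable sigma nsHG)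
  (basis_e : e \in unitmx)
  (Ualpha : alpha \in unitmx) 
  (alphaP : forall h, h \in H ->
     sigma (a * h * a^-1)%g = alpha *m sigma h *m invmx alpha) :
  let Delta := schur_ring irrV in
  let alphaD : {rmorphism Delta -> Delta} :=
    delta_aut nsHG GHa Ualpha alphaP in
  let lam : Delta := delta_lam irrV nsHG indexH GHa Ualpha alphaP in
  let ax : cyclic_axiom alphaD lam p :=
    delta_cyclic_axiom irrV nsHG p_pr indexH GHa Ualpha alphaP in
  let sigmaG := induced_repr sigma (normal_sub nsHG) in
  let B := induced_basis p G sigma a e alpha in
  let X := block_shift p 1%:M (conjmx e lam) in
  let D (delta : Delta) :=
    \mxdiag_(i < p) conjmx e (iter i alphaD delta) in
  [/\ row_free B /\ row_full B,
      conjmx B (sigmaG a) =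
        block_shift p (conjmx e alpha) (conjmx e (alpha *m lam)),
      forall h, h \in H ->
        conjmx B (sigmaG h) = \mxdiag_(i < p) conjmx e (sigma h)
    & exists f : {rmorphism cyclic_algebra ax -> endo sigmaG},
        [/\ bijective f,
            forall (c : F) (u : cyclic_algebra ax),
              f (cyclic_const ax (c *: (1 : Delta)) * u) = c *: f u
          & forall delta : 'I_p -> Delta,
              conjmx B (f (\sum_(i < p)
                  cyclic_const ax (delta i) * cyclic_x ax ^+ i))
              = \sum_(i < p) D (delta i) *m X ^+ i]].
Proof.
move=> Delta alphaD lam ax sigmaG B X D.
have ind := induced_repr_axiom sigma (normal_sub nsHG).
have freeB : row_free B.
  rewrite /B induced_basisE.
  exact: (twist_basis_free nsHG p_pr indexH GHa Ualpha ind basis_e).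
have fullB : row_full B.
  rewrite /B induced_basisE.
  exact: (twist_basis_full nsHG p_pr indexH GHa Ualpha ind basis_e).
(* The index [p.-1.+1] is the form in which one shift leaves the last copy; wrapping round to copy 0
   puts lambda in the lower left corner. *)
have lastE : twist a alpha (tensor_mx G sigma) p.-1.+1
    = endo_val lam *m twist a alpha (tensor_mx G sigma) 0.
  rewrite prednK ?prime_gt0 //.
  by rewrite (twist_p irrV nsHG p_pr indexH GHa Ualpha alphaP ind).
split=> //.
- apply: conjmx_eq => //; rewrite /B induced_basisE.
  apply: (twist_basis_shift p_pr basis_e) => [i _|].
    exact: (twist_a GHa Ualpha ind).
  by rewrite (twist_a GHa Ualpha ind) lastE mulmxA.
- move=> h Hh; apply: conjmx_eq => //; rewrite /B induced_basisE.
  apply: (twist_basis_diag basis_e) => i.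
  exact: (twistJ nsHG GHa Ualpha alphaP ind).
have [f [f_bij fZ fE]] :=
  cyclic_endo_iso irrV nsHG p_pr indexH GHa Ualpha alphaP ind.
exists f; split=> // delta; rewrite fE; apply: conjmx_eq => //.
set Y := endo_shift _ _ _ _ _ _ _.
(* As [B] is row-free, an identity [B *m M = N *m B] determines [N]; such identities are stable
   under sums and products, so X and the D(delta) suffice. *)
have BX : B *m endo_val Y = X *m B.
  (* The identity block is its own conjugate by [e], so [X] has the shape produced by
     [twist_basis_shift]. *)
  have -> : X = block_shift p (conjmx e 1%:M) (conjmx e lam).
    by rewrite conjmx_scalar // row_free_unit.
  rewrite /B induced_basisE.
  apply: (twist_basis_shift p_pr basis_e) => [i _|].
    by rewrite mul1mx (endo_shiftE nsHG p_pr indexH GHa Ualpha alphaP ind).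
  by rewrite (endo_shiftE nsHG p_pr indexH GHa Ualpha alphaP ind) lastE.
have BXi i : B *m endo_val (Y ^+ i) = X ^+ i *m B.
  elim: i => [|i IHi]; first by rewrite !expr0 [LHS]mulmx1 mul1mx.
  by rewrite exprSr endo_valM mulmxA IHi -mulmxA BX mulmxA exprSr.
have BD (c : Delta) :
    B *m endo_val (endo_diag (irrV := irrV)
      nsHG p_pr indexH GHa Ualpha alphaP ind c) = D c *m B.
  rewrite /B induced_basisE.
  apply: (twist_basis_diag basis_e (D := fun i => iter i alphaD c)) => i.
  exact: (endo_diagE (irrV := irrV) nsHG p_pr indexH GHa Ualpha alphaP ind).
rewrite (big_morph (@endo_val _ _ _ _ sigmaG) (id1 := 0) (op1 := +%R)) //.
rewrite mulmx_sumr mulmx_suml; apply: eq_bigr => i _.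
by rewrite endo_valM mulmxA BD -mulmxA BXi mulmxA.
Qed.
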